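(* Let $(X,d,\mu)$ be a metric measure space such that either $(X,d)$ is geometrically doubling, or $\mu$ satisfies a local comparability condition. Then for every $1\le p<\infty$ and every $f\in L^p(\mu)$, $\lim_{r\to 0} A_r f = f$ in $L^p(\mu)$, i.e. $\lim_{r\to 0}\|A_r f - f\|_{L^p(\mu)}=0$.
   Context: Balls: in a metric space $(X,d)$, $B^{o}(x,r) = \{y\in X: d(x,y)<r\}$ and $B^{cl}(x,r)=\{y\in X: d(x,y)\le r\}$. The notation $B(x,r)$ means that all balls under consideration are of the same kind: either all open or all closed; the claim is made in both cases. Metric measure space: a Borel measure $\mu$ on $X$ is $\tau$-additive if for every collection $\{U_\alpha:\alpha\in\Lambda\}$ of open sets, $\mu(\cup_\alpha U_\alpha)=\sup_{\mathcal F}\mu(\cup_{i=1}^n U_{\alpha_i})$, the supremum being over all finite subcollections $\mathcal F=\{U_{\alpha_1},\dots,U_{\alpha_n}\}$. $(X,d,\mu)$ is a metric measure space if $\mu$ is a $\tau$-additive Borel measure on the metric space $(X,d)$ which assigns finite measure to bounded Borel sets; $\mu$ is always assumed not identically $0$. The support of $\mu$ is the complement of $\bigcup\{B^{o}(x,r): x\in X,\ \mu B^{o}(x,r)=0\}$; by $\tau$-additivity $\mu(X\setminus\operatorname{supp}\mu)=0$. Averaging operator: for $r>0$, $g$ locally integrable and $x\in\operatorname{supp}\mu$ (hence for almost every $x$), $A_r g(x):=\frac{1}{\mu(B(x,r))}\int_{B(x,r)} g\,d\mu$. Geometrically doubling: there is a positive integer $D$ such that every ball of radius $r$ can be covered with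 no more than $D$ balls of radius $r/2$ (for all $r>0$). Local comparability: $\mu$ satisfies a local comparability condition if there exists a constant $C\in[1,\infty)$ such that for all pairs of points $x,y\in X$ and every $r>0$, whenever $d(x,y)<r$ we have $\mu(B(x,r))\le C\,\mu(B(y,r))$. *)

(* Defs.v *)
From HB Require Import structures.
From mathcomp Require Import all_boot all_order all_algebra.
From mathcomp Require Import all_classical all_reals all_analysis.

Set Implicit Arguments.
Unset Strict Implicit.
Unset Printing Implicit Defensive.

Import Order.TTheory GRing.Theory Num.Theory.
Import numFieldNormedType.Exports.

Local Open Scope classical_set_scope.
Local Open Scope ring_scope.

(* No compatibility between the metric and the sigma-algebra is built in: that
   the measurable sets are the Borel sets is a field of metric_measure_space. *)
#[short(type="measurableMetricType")]
HB.structure Definition MeasurableMetric (d : measure_display)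
  (R : numDomainType) := { X of Measurable d X & Metric R X }.

Variant ball_kind := OpenBall | ClosedBall.

(* The closed ball is not the library's closed_ball, which is the closure of
   the open ball. *)
Definition kball (R : numDomainType) (X : metricType R) (k : ball_kind)
    (x : X) (r : R) : set X :=
  match k with
  | OpenBall => ball x r
  | ClosedBall => [set y | mdist x y <= r]
  end.

Definition metric_bounded (R : numDomainType) (X : metricType R) (A : set X) :=
  exists M : R, forall x y, A x -> A y -> mdist x y <= M.

Definition geometrically_doubling (R : realType) (X : metricType R)
    (k : ball_kind) : Prop :=
  exists2 D : nat, (0 < D)%N &
    forall (x : X) (r : R), 0 < r ->
      exists2 s : seq X, (size s <= D)%N &
        kball k x r `<=` \bigcup_(y in [set` s]) kball k y (r / 2).

Section metric_measure.
Context (d : measure_display) (R : realType) (X : measurableMetricType d R).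
Variable mu : {measure set X -> \bar R}.

Definition tau_additive : Prop :=
  forall F : set (set X), (forall U, F U -> open U) ->
    mu (\bigcup_(U in F) U) =
    ereal_sup [set mu (\bigcup_(U in G) U) |
               G in [set G | finite_set G /\ G `<=` F]].

Record metric_measure_space : Prop := MetricMeasureSpace {
  mms_borel : @measurable d X = <<s @open X >> ;
  mms_tau_additive : tau_additive ;
  mms_bounded_finite : forall A : set X,
    measurable A -> metric_bounded A -> (mu A < +oo)%E ;
  mms_neq0 : mu [set: X] <> 0%E
}.

Definition msupport : set X :=
  ~` \bigcup_(xr in [set xr : X * R | 0 < xr.2 /\ mu (ball xr.1 xr.2) = 0%E])
       ball xr.1 xr.2.

(* Extended by 0 to the complement of the support, a null set. *)
Definition averaging (k : ball_kind) (r : R) (g : X -> R) : X -> R :=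
  (fun x => (fine (mu (kball k x r)))^-1 *
            (\int[mu]_(y in kball k x r) g y)) \_ msupport.

Definition local_comparability (k : ball_kind) : Prop :=
  exists2 C : R, 1 <= C &
    forall (x y : X) (r : R), 0 < r -> mdist x y < r ->
      (mu (kball k x r) <= C%:E * mu (kball k y r))%E.

End metric_measure.

(* Main.v *)
Require Import Defs.
From HB Require Import structures.
From mathcomp Require Import all_boot all_order all_algebra.
From mathcomp Require Import all_classical all_reals all_analysis.
From mathcomp Require Import measurable_realfun.
From mathcomp Require Import ring lra.

Import Order.TTheory GRing.Theory Num.Theory.
Import numFieldNormedType.Exports.

Local Open Scope classical_set_scope.
Local Open Scope ring_scope.

(** Write [K_r (x, y)] for [1 / mu (B (x, r))] when [x] and [y] are points of
    the support at distance less than (for closed balls, at most) [r], and [0]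
    otherwise, so that [averaging r f x] is the integral of [f] against
    [K_r (x, _)] for [x] in the support.  By convexity of the [p]-th power, the
    [p]-th power of [‖A_r f - f‖_p] is at most the oscillation
<<
      osc_r f = ∫∫ K_r (x, y) |f y - f x|^p dmu(y) dmu(x),
>>
    and it suffices to show that [osc_r f] tends to [0].

    The two alternative hypotheses on the space enter only through one estimate:
    [∫ K_r (x, y) dmu(x) <= C], uniformly in [y] and [r].  Under local
    comparability the integrand is at most [C / mu (B (y, r))] on [B (y, r)].
    Under doubling, [B (y, r)] is covered by [D] balls [B'] of radius [r / 2];
    each of them lies in [B (x, r)] for every [x] in [B'], so it contributes at
    most [1].  Together with the trivial bound on the integral in the other
    variable, Tonelli's theorem gives [osc_r f <= 2^p (1 + C) ‖f‖_p^p]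
    ([schur_test], [oscillation_le_norm]), hence the set of [f] whose oscillation
    vanishes is a closed linear subspace of [L^p].

    This subspace contains the indicator of an open set [U] of finite measure:
    the integrand is supported where exactly one of [x], [y] belongs to [U], and
    that one is then within [r] of the complement of [U]; so the oscillation is
    at most [(1 + C) mu {z in U | dist (z, ~U) < r}], up to enlarging [r], and
    these sets decrease to the empty set ([osc_vanishes_open]).  Dynkin's
    pi-lambda theorem passes from open sets to Borel sets, and simple functions
    are dense in [L^p] ([osc_vanishes_Lp]).

    Tonelli's theorem requires [K_r] to be measurable for the product
    sigma-algebra, which in a nonseparable space need not contain all Borel subsets
    of the square.  This is where tau-additivity is used: it makes
    the support of [mu] separable ([msupport_separable]), and of full measure. *)

Set Implicit Arguments.
Unset Strict Implicit.

(** * Preliminaries on measures, integrals and powers *)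

(** Tonelli's theorem is stated for measures bundled with a proof of
    sigma-finiteness; this recovers such a bundle without changing the
    measure. *)
Lemma sigma_finite_measure_of (d : measure_display) (T : measurableType d)
    (R : realType) (mu : {measure set T -> \bar R}) :
  sigma_finite setT mu ->
  exists m : {sigma_finite_measure set T -> \bar R},
    (m : {measure set T -> \bar R}) = mu.
Proof.
case: mu => mu [c1 c2] s.
pose M : {measure set T -> \bar R} := Measure.Pack (Measure.Class c2).
have s' : sigma_finite setT M by [].
by exists (HB.pack_for {sigma_finite_measure set T -> \bar R} (Measure.sort M)
  (Measure_isSigmaFinite.Build _ _ _ M s')).
Qed.

(** The integral of a nonnegative function is the supremum of the integrals of
    the simple functions below it, so monotonicity needs no measurability.  The
    averages [A_r f] can thus be bounded without showing them measurable. *)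
Lemma ge0_le_lower_integral (d : measure_display) (T : measurableType d)
    (R : realType) (mu : {measure set T -> \bar R}) (f g : T -> \bar R) :
  (forall x, 0 <= f x)%E -> (forall x, f x <= g x)%E ->
  (\int[mu]_x f x <= \int[mu]_x g x)%E.
Proof.
move=> f0 fg; have g0 x : (0 <= g x)%E by exact: le_trans (f0 x) (fg x).
rewrite !ge0_integralTE//; apply: ge_ereal_sup => _ [h /= hf <-].
by apply: ereal_sup_ubound; exists h => //= x; exact: le_trans (hf x) (fg x).
Qed.

(** From [|a + b| <= 2 max(|a|, |b|)]; a crude substitute for the triangle
    inequality, at the cost of the factor [2 `^ p]. *)
Lemma powR_normD (R : realType) (p a b : R) : 0 <= p ->
  `|a + b| `^ p <= 2 `^ p * (`|a| `^ p + `|b| `^ p).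
Proof.
move=> p0; wlog ab : a b / `|a| <= `|b|.
  move=> wl; have [/wl//|/ltW/wl] := leP `|a| `|b|.
  by rewrite addrC [X in _ * X]addrC.
have le2 : `|a + b| <= 2 * `|b|.
  by rewrite (le_trans (ler_normD _ _))// mulr_natl mulr2n lerD2r.
rewrite (le_trans (ge0_ler_powR p0 _ _ le2))// ?nnegrE ?mulr_ge0//.
by rewrite powRM// ler_wpM2l ?powR_ge0// lerDr powR_ge0.
Qed.

(** * Kernels with bounded marginals and their oscillations *)

Section schur_kernel.
Context (d : measure_display) (T : measurableType d) (R : realType).
Variable mu : {sigma_finite_measure set T -> \bar R}.
Implicit Types (C p : R) (K : T * T -> R) (f g : T -> R).

(** The hypotheses of Schur's test: rows of mass at most [1] (an average) and
    columns of mass at most [C]. *)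
Record schur_kernel C K : Prop := SchurKernel {
  schur_measurable : measurable_fun setT K ;
  schur_ge0 : forall z, 0 <= K z ;
  schur_row : forall x, (\int[mu]_y (K (x, y))%:E <= 1)%E ;
  schur_col : forall y, (\int[mu]_x (K (x, y))%:E <= C%:E)%E }.

(** The part in [f] is integrated in [y] first and uses the rows; the part in
    [g] is integrated in [x] first, after Tonelli, and uses the columns. *)
Lemma schur_test C K f g : schur_kernel C K ->
  measurable_fun setT f -> measurable_fun setT g ->
  (forall x, 0 <= f x) -> (forall x, 0 <= g x) ->
  (\int[mu]_x \int[mu]_y (K (x, y) * (f x + g y))%:E <=
   \int[mu]_x (f x)%:E + C%:E * \int[mu]_y (g y)%:E)%E.
Proof.
move=> [mK K0 Krow Kcol] mf mg f0 g0.
have C0 : T -> 0 <= C.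
  move=> y; rewrite -lee_fin (le_trans _ (Kcol y))// integral_ge0// => x _.
  by rewrite lee_fin.
have mKx x : measurable_fun setT (fun y => K (x, y)).
  by apply: measurableT_comp => //; exact: measurable_fun_pair.
have mKy y : measurable_fun setT (fun x => K (x, y)).
  by apply: measurableT_comp => //; exact: measurable_fun_pair.
have mKf : measurable_fun setT (fun z => (K z * f z.1 : R)%:E).
  apply/measurable_EFinP; apply: measurable_funM => //.
  exact: measurableT_comp.
have mKg : measurable_fun setT (fun z => (K z * g z.2 : R)%:E).
  apply/measurable_EFinP; apply: measurable_funM => //.
  exact: measurableT_comp.
have Kf0 z : (0 <= (K z * f z.1)%:E)%E by rewrite lee_fin mulr_ge0.
have Kg0 z : (0 <= (K z * g z.2)%:E)%E by rewrite lee_fin mulr_ge0.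
have -> : (\int[mu]_x \int[mu]_y (K (x, y) * (f x + g y))%:E =
    \int[mu]_x \int[mu]_y (K (x, y) * f x)%:E +
    \int[mu]_x \int[mu]_y (K (x, y) * g y)%:E)%E.
  have If0 x : [set: T] x -> (0 <= \int[mu]_y (K (x, y) * f x)%:E)%E.
    by move=> _; apply: integral_ge0 => y _; exact: (Kf0 (x, y)).
  have Ig0 x : [set: T] x -> (0 <= \int[mu]_y (K (x, y) * g y)%:E)%E.
    by move=> _; apply: integral_ge0 => y _; exact: (Kg0 (x, y)).
  rewrite -(ge0_integralD _ measurableT If0 _ Ig0); last 2 first.
  - exact: (measurable_fun_fubini_tonelli_F _ mKf Kf0).
  - exact: (measurable_fun_fubini_tonelli_F _ mKg Kg0).
  apply: eq_integral => x _.
  rewrite -(ge0_integralD _ measurableT (fun y _ => Kf0 (x, y)) _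
    (fun y _ => Kg0 (x, y))).
  - by apply: eq_integral => y _; rewrite mulrDr EFinD.
  - by apply/measurable_EFinP; apply: measurable_funM => //=; exact: measurable_cst.
  - by apply/measurable_EFinP; apply: measurable_funM.
apply: leeD.
  apply: ge0_le_lower_integral => x.
    by apply: integral_ge0 => y _; exact: (Kf0 (x, y)).
  under eq_integral do rewrite mulrC EFinM.
  rewrite ge0_integralZl_EFin//; last 2 first.
  - by move=> y _; rewrite lee_fin.
  - exact/measurable_EFinP.
  rewrite -[leRHS]mule1 lee_pmul ?lee_fin// integral_ge0// => y _.
  by rewrite lee_fin.
rewrite (fubini_tonelli (fun z => (K z * g z.2 : R)%:E))//=.
(* [0 <= C] comes from any column, so an empty space is set apart. *)
have [[x0]|T0] := pselect (inhabited T); last first.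
  have z h : (\int[mu]_y h y = 0)%E.
    by apply: integral0_eq => x; exfalso; apply: T0; constructor.
  by rewrite !z mule0.
rewrite -ge0_integralZl_EFin//; last 3 first.
- by move=> y _; rewrite lee_fin.
- exact/measurable_EFinP.
- exact: C0.
apply: ge0_le_lower_integral => y.
  by apply: integral_ge0 => x _; exact: (Kg0 (x, y)).
under eq_integral do rewrite mulrC EFinM.
rewrite ge0_integralZl_EFin//; last 2 first.
- by move=> x _; rewrite lee_fin.
- exact/measurable_EFinP.
by rewrite muleC lee_pmul ?lee_fin// integral_ge0// => x _; rewrite lee_fin.
Qed.

(** For the averaging kernel, this is the integral over [x] of the mean of
    [|f y - f x|^p] over [y] in the ball around [x]. *)
Definition oscillation p K f : \bar R :=
  (\int[mu]_x \int[mu]_y (K (x, y) * `|f y - f x| `^ p)%:E)%E.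

Lemma measurable_powR_norm p f : measurable_fun setT f ->
  measurable_fun setT (fun x => `|f x| `^ p).
Proof.
move=> mf.
by apply: (measurableT_comp (measurable_powR p)); exact: measurableT_comp.
Qed.

Lemma measurable_osc_integrand C K p f : schur_kernel C K ->
  measurable_fun setT f ->
  measurable_fun setT (fun z => (K z * `|f z.2 - f z.1| `^ p : R)%:E).
Proof.
move=> [mK _ _ _] mf; apply/measurable_EFinP; apply: measurable_funM => //.
apply: (measurableT_comp (measurable_powR p)); apply: measurableT_comp => //.
by apply: measurable_funB; exact: measurableT_comp.
Qed.

Lemma oscillation_le_norm C K p f : schur_kernel C K -> 0 <= p ->
  measurable_fun setT f ->
  (oscillation p K f <=
    (2 `^ p)%:E * (\int[mu]_x (`|f x| `^ p)%:E
      + C%:E * \int[mu]_x (`|f x| `^ p)%:E))%E.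
Proof.
move=> kK p0 mf; have mfp := measurable_powR_norm p mf.
have K0 := schur_ge0 kK.
have h := schur_test kK mfp mfp (fun=> powR_ge0 _ _) (fun=> powR_ge0 _ _).
apply: (@le_trans _ _ ((2 `^ p)%:E * (\int[mu]_x \int[mu]_y
    (K (x, y) * (`|f x| `^ p + `|f y| `^ p))%:E))%E); last first.
  by rewrite lee_wpmul2l// lee_fin powR_ge0.
have pz (z : T * T) : (0 <= (K z * (`|f z.1| `^ p + `|f z.2| `^ p))%:E)%E.
  by rewrite lee_fin mulr_ge0// addr_ge0 ?powR_ge0.
have mz : measurable_fun setT
    (fun z => (K z * (`|f z.1| `^ p + `|f z.2| `^ p) : R)%:E).
  apply/measurable_EFinP; apply: measurable_funM.
    exact: schur_measurable kK.
  by apply: measurable_funD; exact: (measurableT_comp mfp).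
rewrite -ge0_integralZl_EFin ?powR_ge0//; last 2 first.
- by move=> x _; apply: integral_ge0 => y _; exact: (pz (x, y)).
- exact: (measurable_fun_fubini_tonelli_F _ mz pz).
apply: ge0_le_lower_integral => x.
  by apply: integral_ge0 => y _; rewrite lee_fin mulr_ge0 ?powR_ge0.
rewrite -(ge0_integralZl_EFin _ measurableT (fun y _ => pz (x, y)))
  ?powR_ge0//; last first.
  by apply: (measurableT_comp mz); exact: measurable_fun_pair.
apply: ge0_le_lower_integral => y.
  by rewrite lee_fin mulr_ge0 ?powR_ge0.
rewrite -EFinM lee_fin mulrCA ler_wpM2l// addrC.
by rewrite (le_trans (powR_normD _ _ p0))// normrN addrC.
Qed.

Lemma oscillationD C K p f g : schur_kernel C K -> 0 <= p ->
  measurable_fun setT f -> measurable_fun setT g ->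
  (oscillation p K (f \+ g)%R <=
    (2 `^ p)%:E * (oscillation p K f + oscillation p K g))%E.
Proof.
move=> kK p0 mf mg; have K0 := schur_ge0 kK.
have mz := measurable_osc_integrand p kK mf.
have mz' := measurable_osc_integrand p kK mg.
have p0' (h : T -> R) (z : T * T) : (0 <= (K z * `|h z.2 - h z.1| `^ p)%:E)%E.
  by rewrite lee_fin mulr_ge0 ?powR_ge0.
have pz := p0' f; have pz' := p0' g.
have pzi (h : T -> R) x : (0 <= \int[mu]_y (K (x, y) * `|h y - h x| `^ p)%:E)%E.
  by apply: integral_ge0 => y _; exact: (p0' h (x, y)).
rewrite /oscillation -ge0_integralD//; last 2 first.
- exact: (measurable_fun_fubini_tonelli_F _ mz pz).
- exact: (measurable_fun_fubini_tonelli_F _ mz' pz').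
rewrite -ge0_integralZl_EFin ?powR_ge0//; last 2 first.
- by move=> x _; rewrite adde_ge0.
- apply: emeasurable_funD; first exact: (measurable_fun_fubini_tonelli_F _ mz pz).
  exact: (measurable_fun_fubini_tonelli_F _ mz' pz').
apply: ge0_le_lower_integral => [//|x].
have mzx : measurable_fun setT (fun y => (K (x, y) * `|f y - f x| `^ p : R)%:E).
  by apply: (measurableT_comp mz); exact: measurable_fun_pair.
have mzx' : measurable_fun setT (fun y => (K (x, y) * `|g y - g x| `^ p : R)%:E).
  by apply: (measurableT_comp mz'); exact: measurable_fun_pair.
rewrite -(ge0_integralD _ measurableT (fun y _ => pz (x, y)) mzx
  (fun y _ => pz' (x, y)) mzx') -ge0_integralZl_EFin ?powR_ge0//; last 2 first.
- by move=> y _; rewrite adde_ge0.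
- exact: emeasurable_funD.
apply: ge0_le_lower_integral => y; first exact: (p0' (f \+ g) (x, y)).
rewrite -EFinD -EFinM lee_fin -mulrDr mulrCA ler_wpM2l//=.
by rewrite opprD addrACA powR_normD.
Qed.

End schur_kernel.
Lemma ge0_cvge0P (R : realType) (I : Type) (F : set_system I)
    (u : I -> \bar R) :
  Filter F -> (forall i, 0 <= u i)%E ->
  u i @[i --> F] --> 0%E <->
  (forall e : R, 0 < e -> \forall i \near F, (u i <= e%:E)%E).
Proof.
move=> FF u0; split.
  move=> /fine_cvgP[ufin /cvgr0_norm_le ucvg] e e0.
  have {}ucvg := ucvg _ e0; near=> i.
  have fi : u i \is a fin_num by near: i.
  rewrite -(fineK fi) lee_fin (le_trans (ler_norm _))//.
  by near: i; exact: ucvg.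
move=> ule; have fin : \forall i \near F, u i \is a fin_num.
  near=> i; rewrite ge0_fin_numE// (@le_lt_trans _ _ 1%:E) ?ltry//.
  by near: i; exact: ule.
apply/fine_cvgP; split => //.
apply/cvgrPdist_le => /= e e0; near=> i.
rewrite sub0r normrN ger0_norm ?fine_ge0// -lee_fin fineK; last by near: i.
by near: i; exact: ule.
Unshelve. all: by end_near. Qed.

(** * Functions of vanishing oscillation form a closed subspace *)

Section osc_vanishes.
Context (d : measure_display) (T : measurableType d) (R : realType).
Variable mu : {sigma_finite_measure set T -> \bar R}.
Variables (C p : R) (K : R -> T * T -> R).
Hypotheses (p0 : 0 < p) (kK : forall r, 0 < r -> schur_kernel mu C (K r)).
Implicit Types (f g : T -> R).

Definition osc_vanishes f := forall e : R, 0 < e ->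
  \forall r \near 0^'+, (oscillation mu p (K r) f <= e%:E)%E.

Lemma osc_vanishesD f g : measurable_fun setT f -> measurable_fun setT g ->
  osc_vanishes f -> osc_vanishes g -> osc_vanishes (f \+ g).
Proof.
move=> mf mg vf vg e e0.
have c0 : 0 < 2 `^ p * 2 :> R by rewrite mulr_gt0// powR_gt0.
have e'0 : 0 < e / (2 `^ p * 2) by rewrite divr_gt0.
have := vf _ e'0; have := vg _ e'0; apply: filterS3; last exact: nbhs_right_gt.
move=> r r0 vgr vfr; apply: le_trans (oscillationD (kK r0) (ltW p0) mf mg) _.
have -> : e%:E = ((2 `^ p)%:E * ((e / (2 `^ p * 2))%:E + (e / (2 `^ p * 2))%:E))%E.
  by rewrite -EFinD -EFinM; congr EFin; field; rewrite gt_eqF ?powR_gt0.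
apply: lee_wpmul2l; first by rewrite lee_fin powR_ge0.
exact: leeD vfr vgr.
Qed.

(** Closedness in [L^p]: [osc f] is at most [2^p (osc (f - g) + osc g)], and
    [osc (f - g)] is controlled by the norm of [f - g], uniformly in [r]. *)
Lemma osc_vanishes_approx f : measurable_fun setT f ->
  (forall e : R, 0 < e -> exists g, [/\ measurable_fun setT g, osc_vanishes g &
    (\int[mu]_x (`|f x - g x| `^ p)%:E <= e%:E)%E]) ->
  osc_vanishes f.
Proof.
move=> mf apx e e0.
(* The two factors [2 `^ p] come from [oscillationD] and [oscillation_le_norm],
   and the factor [2] shares [e] between [osc (f - g)] and [osc g]. *)
pose c : R := 2 `^ p * (2 `^ p * (1 + `|C|)) * 2.
have pp : 0 < 2 `^ p :> R by rewrite powR_gt0.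
have C1 : 0 < 1 + `|C| by rewrite ltr_pwDl.
have c0 : 0 < c by rewrite !mulr_gt0.
have [g [mg vg fg]] := apx (e / c) (divr_gt0 e0 c0).
have e'0 : 0 < e / (2 `^ p * 2) by rewrite divr_gt0// mulr_gt0.
have := vg _ e'0; apply: filterS2; last exact: nbhs_right_gt.
move=> r r0 vgr.
have mfg : measurable_fun setT (f \- g) by exact: measurable_funB.
have -> : f = (f \- g) \+ g by apply/funext => x /=; rewrite subrK.
apply: le_trans (oscillationD (kK r0) (ltW p0) mfg mg) _.
have ofg : (oscillation mu p (K r) (f \- g)%R <= (e / (2 `^ p * 2))%:E)%E.
  apply: le_trans (oscillation_le_norm (kK r0) (ltW p0) mfg) _ => /=.
  have -> : (e / (2 `^ p * 2))%:E =
      ((2 `^ p)%:E * ((e / c)%:E + `|C|%:E * (e / c)%:E))%E.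
    rewrite -!(EFinM, EFinD); congr EFin; rewrite /c.
    by field; rewrite !gt_eqF.
  apply: lee_wpmul2l; first by rewrite lee_fin powR_ge0.
  have I0 : (0 <= \int[mu]_x (`|f x - g x| `^ p)%:E)%E.
    by apply: integral_ge0 => x _; rewrite lee_fin powR_ge0.
  apply: (leeD fg).
  apply: (@le_trans _ _ (`|C|%:E * \int[mu]_x (`|f x - g x| `^ p)%:E)%E).
    by apply: lee_wpmul2r => //; rewrite lee_fin ler_norm.
  by apply: lee_wpmul2l => //; rewrite lee_fin.
have -> : e%:E = ((2 `^ p)%:E * ((e / (2 `^ p * 2))%:E + (e / (2 `^ p * 2))%:E))%E.
  by rewrite -EFinD -EFinM; congr EFin; field; rewrite gt_eqF.
apply: lee_wpmul2l; first by rewrite lee_fin powR_ge0.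
exact: leeD ofg vgr.
Qed.

Lemma osc_vanishesZ (a : R) f : measurable_fun setT f ->
  osc_vanishes f -> osc_vanishes (fun x => a * f x).
Proof.
move=> mf vf e e0.
have a1 : 0 < 1 + `|a| `^ p by rewrite ltr_pwDl// powR_ge0.
have := vf _ (divr_gt0 e0 a1); apply: filterS2; last exact: nbhs_right_gt.
move=> r r0 vr.
have -> : oscillation mu p (K r) (fun x => a * f x) =
    ((`|a| `^ p)%:E * oscillation mu p (K r) f)%E.
  have mz := measurable_osc_integrand p (kK r0) mf.
  have pz (z : T * T) : (0 <= (K r z * `|f z.2 - f z.1| `^ p : R)%:E)%E.
    by rewrite lee_fin mulr_ge0 ?powR_ge0// (schur_ge0 (kK r0)).
  rewrite /oscillation -ge0_integralZl_EFin ?powR_ge0//; last 2 first.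
  - by move=> x _; apply: integral_ge0 => y _; exact: (pz (x, y)).
  - exact: (measurable_fun_fubini_tonelli_F _ mz pz).
  apply: eq_integral => x _.
  rewrite -(ge0_integralZl_EFin _ measurableT (fun y _ => pz (x, y)))
    ?powR_ge0//; last first.
    by apply: (measurableT_comp mz); exact: measurable_fun_pair.
  apply: eq_integral => y _ /=.
  by rewrite -EFinM -mulrBr normrM powRM// mulrCA.
rewrite (@le_trans _ _ ((`|a| `^ p)%:E * (e / (1 + `|a| `^ p))%:E)%E)//.
  by rewrite lee_wpmul2l// lee_fin powR_ge0.
rewrite -EFinM lee_fin mulrCA; apply: ler_piMr; first exact: ltW.
by rewrite ler_pdivrMr// mul1r lerDr.
Qed.

(** Dominated convergence turns pointwise convergence below [|f|] into
    convergence in [L^p]; all the approximations below are of this form. *)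
Lemma osc_vanishes_cvg f (f_ : nat -> T -> R) :
  measurable_fun setT f -> (forall n, measurable_fun setT (f_ n)) ->
  (\int[mu]_x (`|f x| `^ p)%:E < +oo)%E ->
  (forall n x, `|f_ n x| <= `|f x|) ->
  (forall x, f_ n x @[n --> \oo] --> f x) ->
  (forall n, osc_vanishes (f_ n)) -> osc_vanishes f.
Proof.
move=> mf mf_ foo ff fcvg vf_; apply: osc_vanishes_approx => // e e0.
pose u n x : \bar R := (`|f x - f_ n x| `^ p)%:E.
have u0 n x : (0 <= u n x)%E by rewrite lee_fin powR_ge0.
have mu_ n : measurable_fun setT (u n).
  by apply/measurable_EFinP; apply: measurable_powR_norm; exact: measurable_funB.
have iG : mu.-integrable setT
    (fun x => (2 `^ p * (`|f x| `^ p + `|f x| `^ p) : R)%:E).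
  have mfp := measurable_powR_norm p mf.
  have If : mu.-integrable setT (fun x => (`|f x| `^ p)%:E).
    apply/integrableP; split; first exact/measurable_EFinP.
    by under eq_integral do rewrite gee0_abs ?lee_fin ?powR_ge0//.
  under eq_fun do rewrite EFinM EFinD.
  by apply: integrableZl => //; exact: integrableD.
have ug n x : (`|u n x| <= (2 `^ p * (`|f x| `^ p + `|f x| `^ p))%:E)%E.
  rewrite gee0_abs// lee_fin.
  rewrite (le_trans (powR_normD _ _ (ltW p0)))// ler_wpM2l ?powR_ge0//.
  by rewrite lerD2l normrN ge0_ler_powR ?nnegrE// ltW.
have ucvg x : u n x @[n --> \oo] --> 0%E.
  apply/ge0_cvge0P => // c c0.
  have /cvgrPdist_le/= := fcvg x.
  have c'0 : 0 < c `^ p^-1 by rewrite powR_gt0.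
  move=> /(_ _ c'0); apply: filterS => n /= fn.
  rewrite lee_fin (le_trans (ge0_ler_powR (ltW p0) _ _ fn)) ?nnegrE// ?powR_ge0//.
  by rewrite -powRrM mulVf ?gt_eqF// powRr1// ltW.
have mc : measurable_fun setT (cst 0%E : T -> \bar R) by exact: measurable_cst.
have aec : \forall x \ae mu,
    setT x -> u n x @[n --> \oo] --> (cst 0%E : T -> \bar R) x.
  exact: aeW.
have aeg : \forall x \ae mu, forall n, setT x ->
    (`|u n x| <= (2 `^ p * (`|f x| `^ p + `|f x| `^ p))%:E)%E.
  exact: aeW.
have [_ _] := dominated_convergence measurableT mu_ mc aec iG aeg.
rewrite integral0 /= => ucvg0.
have I0 n : (0 <= \int[mu]_x (u n x))%E by exact: integral_ge0.
have [n _ hn] := (ge0_cvge0P _ I0).1 ucvg0 _ e0.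
by exists (f_ n); split => //; exact: hn (leqnn n).
Qed.

End osc_vanishes.
(** * From a generating pi-system to all of L^p *)

Section osc_vanishes_pi_system.
Context (d : measure_display) (T : measurableType d) (R : realType).
Variable mu : {sigma_finite_measure set T -> \bar R}.
Variables (C p : R) (K : R -> T * T -> R).
Hypotheses (p0 : 0 < p) (kK : forall r, 0 < r -> schur_kernel mu C (K r)).
Local Notation vanishes := (osc_vanishes mu p K).
Local Notation ind A := (\1_A : T -> R).

Lemma osc_vanishes_sum (I : Type) (s : seq I) (f_ : I -> T -> R) :
  (forall i, measurable_fun setT (f_ i)) -> (forall i, vanishes (f_ i)) ->
  vanishes (fun x => \sum_(i <- s) f_ i x).
Proof.
move=> mf vf; elim: s => [|i s ih].
  move=> e e0; apply: nearW => r.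
  rewrite /oscillation integral0_eq ?lee_fin ?ltW// => x _.
  rewrite integral0_eq// => y _.
  by rewrite !big_nil subrr normr0 powR0 ?mulr0// gt_eqF.
under eq_fun do rewrite big_cons.
apply: (osc_vanishesD p0 kK (mf i) _ (vf i) ih).
exact: measurable_sum.
Qed.

Variable G : set (set T).
Hypotheses (mG : @measurable _ T = <<s G >>) (GI : setI_closed G).
Hypothesis vG : forall U, G U -> (mu U < +oo)%E -> vanishes (ind U).
Variable B : nat -> set T.
Hypotheses (GB : forall n, G (B n)) (muB : forall n, (mu (B n) < +oo)%E)
  (BT : forall x, \forall n \near \oo, B n x).

Let G_measurable A : G A -> measurable A.
Proof. by move=> GA; rewrite mG; exact: sub_sigma_algebra. Qed.

Let ind_powR A x : `|ind A x| `^ p = ind A x.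
Proof.
rewrite indicE; case: (x \in A); last by rewrite normr0 powR0// gt_eqF.
by rewrite normr1 powR1.
Qed.

Let integral_ind_powR A : measurable A ->
  (\int[mu]_x (`|ind A x| `^ p)%:E)%E = mu A.
Proof.
move=> mA; under eq_integral do rewrite ind_powR.
by rewrite integral_indic// setIT.
Qed.

(** Dynkin's theorem.  Intersecting with [B n] keeps all indicators in [L^p],
    which makes both complements and countable unions available. *)
Lemma osc_vanishes_indic_trunc A n : measurable A -> vanishes (ind (A `&` B n)).
Proof.
rewrite mG => GA; move: n.
have mB n : measurable (B n) by exact: G_measurable.
have vB n : vanishes (ind (B n)) by exact: vG.
pose P := [set A : set T | forall n, vanishes (ind (A `&` B n))].
suff : P A by [].
apply: (dynkin_induction mG GI) GA; rewrite /P /=.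
- by move=> n; rewrite setTI.
- move=> U GU n; apply: vG; first exact: GI.
  by rewrite (le_lt_trans _ (muB n))// le_measure ?inE//;
    apply: measurableI => //; exact: G_measurable.
- move=> S mS vS n.
  have -> : ind (~` S `&` B n) = ind (B n) \+ (fun x => -1 * ind (S `&` B n) x).
    apply/funext => x /=; rewrite !indicE !in_setI in_setC.
    by case: (x \in S); case: (x \in B n); rewrite /= ?mulr0 ?mulr1 ?addr0 ?subrr.
  apply: (osc_vanishesD p0 kK) => //.
  + apply: measurable_funM; first exact: measurable_cst.
    by apply: measurable_indic; exact: measurableI.
  + apply: (osc_vanishesZ kK) => //.
    by apply: measurable_indic; exact: measurableI.
- move=> F mF tF vF n.
  pose f_ N x := \sum_(k <- iota 0 N) ind (F k `&` B n) x.
  have mFB k : measurable (F k `&` B n) by exact: measurableI.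
  have f0 N x : ~ (\bigcup_k F k `&` B n) x -> f_ N x = 0.
    move=> Fx; rewrite /f_ big1_seq// => k _; rewrite indicE memNset//.
    by move=> [Fkx Bx]; apply: Fx; split => //; exists k.
  have f1 N x k : (F k `&` B n) x -> f_ N x = (k < N)%N%:R.
    move=> [Fkx Bx]; rewrite /f_.
    have hj j : j != k -> ind (F j `&` B n) x = 0.
      move=> jk; rewrite indicE memNset// => -[Fjx _].
      by move/eqP: jk; apply; apply: (tF j k) => //; exists x.
    have [kN|kN] := ltnP k N.
      rewrite (bigD1_seq k) ?iota_uniq ?mem_iota//= big1 ?addr0; last first.
        by move=> j jk; exact: hj.
      by rewrite indicE mem_set.
    rewrite big1_seq// => j; rewrite mem_iota/= add0n => jN; apply: hj.
    by rewrite ltn_eqF// (leq_trans jN).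
  (* By disjointness [f_ N] is the indicator of a finite union, hence at most
     the indicator of the whole union. *)
  apply: (@osc_vanishes_cvg _ _ _ _ _ _ _ p0 kK _ f_).
  + by apply: measurable_indic; apply: measurableI => //; exact: bigcupT_measurable.
  + by move=> N; apply: measurable_sum => k; exact: measurable_indic.
  + rewrite integral_ind_powR; last first.
      by apply: measurableI => //; exact: bigcupT_measurable.
    rewrite (le_lt_trans _ (muB n))// le_measure ?inE//.
    by apply: measurableI => //; exact: bigcupT_measurable.
  + move=> N x; have [FBx|FBx] := pselect ((\bigcup_k F k `&` B n) x).
      have [[k _ Fkx] Bx] := FBx.
      rewrite (f1 _ _ k)// indicE mem_set// normr1.
      by case: (k < N)%N; rewrite ?normr1 ?normr0.
    by rewrite f0// normr0.
  + move=> x; have [FBx|FBx] := pselect ((\bigcup_k F k `&` B n) x).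
      have [[k _ Fkx] Bx] := FBx.
      apply: cvg_near_cst; near=> N.
      rewrite (f1 _ _ k)// indicE mem_set//.
      suff -> : (k < N)%N by [].
      by near: N; exact: nbhs_infty_gt.
    apply: cvg_near_cst; near=> N.
    by rewrite f0// indicE memNset.
  + move=> N; apply: osc_vanishes_sum => k; first exact: measurable_indic.
    exact: vF.
Unshelve. all: by end_near. Qed.

Lemma osc_vanishes_indic A : measurable A -> (mu A < +oo)%E -> vanishes (ind A).
Proof.
move=> mA Aoo; have mB n : measurable (B n) by exact: G_measurable.
apply: (@osc_vanishes_cvg _ _ _ _ _ _ _ p0 kK _ (fun n => ind (A `&` B n))).
- exact: measurable_indic.
- by move=> n; apply: measurable_indic; exact: measurableI.
- by rewrite integral_ind_powR.
- move=> n x; rewrite !indicE in_setI.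
  by case: (x \in A); case: (x \in B n); rewrite /= ?normr1 ?normr0.
- move=> x; apply: cvg_near_cst; near=> n.
  rewrite !indicE in_setI andb_idr// => _; apply: mem_set.
  by near: n; exact: BT.
- by move=> n; exact: osc_vanishes_indic_trunc.
Unshelve. all: by end_near. Qed.

Import HBNNSimple.

(** By Chebyshev, a simple function in [L^p] takes each nonzero value on a set
    of finite measure. *)
Lemma osc_vanishes_nnsfun (h : {nnsfun T >-> R}) :
  (\int[mu]_x (`|h x| `^ p)%:E < +oo)%E -> vanishes h.
Proof.
move=> hoo.
have mh y : measurable (h @^-1` [set y]) by exact: measurable_sfunP.
have muh y : y != 0 -> (mu (h @^-1` [set y]) < +oo)%E.
  move=> y0; have yp : 0 < `|y| `^ p by rewrite powR_gt0 ?normr_gt0.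
  suff : ((`|y| `^ p)%:E * mu (h @^-1` [set y]) < +oo)%E.
    case: (mu _) (measure_ge0 mu (h @^-1` [set y])) => [s| |]// _;
      by rewrite ?ltry// gt0_muley ?lte_fin.
  apply: le_lt_trans hoo.
  rewrite -(setIT (h @^-1` [set y])) -integral_indic//.
  rewrite -ge0_integralZl_EFin ?powR_ge0//; last first.
    by apply/measurable_EFinP; exact: measurable_indic.
  apply: ge0_le_lower_integral => x.
    by rewrite -EFinM lee_fin mulr_ge0// powR_ge0.
  rewrite -EFinM lee_fin indicE; have [/set_mem/= <-|_] := boolP (x \in _).
    by rewrite mulr1.
  by rewrite mulr0 powR_ge0.
have -> : (h : T -> R) = fun x =>
    \sum_(y <- finmap.enum_fset (fset_set (range h))) y * ind (h @^-1` [set y]) x.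
  by apply/funext => x; rewrite fimfunE fsbig_finite.
apply: osc_vanishes_sum => y.
  apply: measurable_funM; first exact: measurable_cst.
  exact: measurable_indic.
have [->|y0] := eqVneq y 0.
  move=> e e0; apply: nearW => r.
  rewrite /oscillation integral0_eq ?lee_fin ?ltW// => x _.
  rewrite integral0_eq// => z _.
  by rewrite !mul0r subrr normr0 powR0 ?mulr0// gt_eqF.
apply: (osc_vanishesZ kK); first exact: measurable_indic.
exact: osc_vanishes_indic (muh _ y0).
Qed.

Lemma osc_vanishes_ge0 (f : T -> R) :
  measurable_fun setT f -> (forall x, 0 <= f x) ->
  (\int[mu]_x (`|f x| `^ p)%:E < +oo)%E -> vanishes f.
Proof.
move=> mf f0 foo.
have mEf : measurable_fun setT (fun x => (f x)%:E) by exact/measurable_EFinP.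
have Ef0 x : setT x -> (0 <= (f x)%:E)%E by rewrite lee_fin.
pose f_ := nnsfun_approx measurableT mEf.
have cvgf x : f_ n x @[n --> \oo] --> f x.
  by have /fine_cvgP[_] := cvg_nnsfun_approx measurableT mEf Ef0 (I : setT x).
have ndf x : nondecreasing_seq (fun n => f_ n x).
  by move=> m n mn; have /lefP := nd_nnsfun_approx measurableT mEf mn; exact.
have f_le n x : f_ n x <= f x.
  rewrite -(cvg_lim _ (cvgf x))//; apply: nondecreasing_cvgn_le => //.
  by apply/cvg_ex; exists (f x).
have f_le' n x : `|f_ n x| <= `|f x| by rewrite !ger0_norm.
apply: (@osc_vanishes_cvg _ _ _ _ _ _ _ p0 kK _ f_) => //.
move=> n; apply: osc_vanishes_nnsfun; apply: le_lt_trans foo.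
apply: ge0_le_lower_integral => x; first by rewrite lee_fin powR_ge0.
by rewrite lee_fin ge0_ler_powR ?nnegrE// ltW.
Qed.

Lemma osc_vanishes_Lp (f : T -> R) : measurable_fun setT f ->
  (\int[mu]_x (`|f x| `^ p)%:E < +oo)%E -> vanishes f.
Proof.
move=> mf foo.
have -> : f = f^\+ \+ (fun x => -1 * f^\- x).
  by rewrite -[LHS]funrposBneg; apply/funext => x /=; rewrite mulN1r.
have mp : measurable_fun setT f^\+ by exact: measurable_funrpos.
have mn : measurable_fun setT f^\- by exact: measurable_funrneg.
have le_oo (g : T -> R) : (forall x, `|g x| <= `|f x|) ->
    (\int[mu]_x (`|g x| `^ p)%:E < +oo)%E.
  move=> gf; apply: le_lt_trans foo; apply: ge0_le_lower_integral => x.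
    by rewrite lee_fin powR_ge0.
  by rewrite lee_fin ge0_ler_powR ?nnegrE// ltW.
apply: (osc_vanishesD p0 kK) => //.
- by apply: measurable_funM => //; exact: measurable_cst.
- apply: osc_vanishes_ge0 => //; apply: le_oo => x.
  by rewrite /funrpos ger0_norm ?le_max ?lexx ?orbT// ge_max normr_ge0 ler_norm.
- apply: (osc_vanishesZ kK) => //.
  apply: osc_vanishes_ge0 => //; apply: le_oo => x.
  rewrite /funrneg ger0_norm ?le_max ?lexx ?orbT// ge_max normr_ge0.
  by rewrite ler_normr lexx orbT.
Qed.

End osc_vanishes_pi_system.
(** * Balls and support of a metric measure space *)

Section metric_measure_space_theory.
Context (d : measure_display) (R : realType) (X : measurableMetricType d R).
Variable mu : {measure set X -> \bar R}.
Hypothesis Xmu : metric_measure_space mu.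
Implicit Types (x y z : X) (r e : R) (k : ball_kind).

Let supp : set X := msupport mu.

Lemma metric_ball_open x r : open (ball x r).
Proof.
rewrite openE => y; rewrite ballEmdist/= => xyr.
apply/nbhs_ballP; exists (r - mdist x y) => /=; first by rewrite subr_gt0.
move=> z; rewrite !ballEmdist/= => yz.
by rewrite (le_lt_trans (metric_triangle _ y _))// -ltrBrDl.
Qed.

Lemma open_measurable_mms (U : set X) : open U -> measurable U.
Proof. by move=> oU; rewrite (mms_borel Xmu); exact: sub_sigma_algebra. Qed.

Lemma measurable_metric_ball x r : measurable (ball x r).
Proof. exact/open_measurable_mms/metric_ball_open. Qed.

Lemma closed_kballE x r :
  kball ClosedBall x r = \bigcap_n kball ClosedBall x (r + n.+1%:R^-1).
Proof.
apply/seteqP; split => [y /= xy n _ /=|y xy /=].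
  by rewrite (le_trans xy)// lerDl invr_ge0.
rewrite leNgt; apply/negP => /ltr_add_invr[n].
by rewrite ltNge => /negP; apply; exact: xy.
Qed.

Lemma closed_kball_ballE x r :
  kball ClosedBall x r = \bigcap_n ball x (r + n.+1%:R^-1).
Proof.
apply/seteqP; split => [y /= xy n _ |y xy /=].
  by rewrite ballEmdist/= (le_lt_trans xy)// ltrDl invr_gt0.
rewrite leNgt; apply/negP => /ltr_add_invr[n].
rewrite ltNge => /negP; apply; apply: ltW.
by have := xy n I; rewrite ballEmdist.
Qed.

Lemma measurable_kball k x r : measurable (kball k x r).
Proof.
case: k; first exact: measurable_metric_ball.
rewrite closed_kball_ballE; apply: bigcapT_measurable => n.
exact: measurable_metric_ball.
Qed.

Lemma ball_sub_kball k x r : ball x r `<=` kball k x r.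
Proof. by case: k => // y; rewrite ballEmdist/= => /ltW. Qed.

Lemma kball_sub_ball k x r s : r < s -> kball k x r `<=` ball x s.
Proof.
case: k => rs y /=; rewrite !ballEmdist/= => xy; first exact: lt_trans xy rs.
exact: le_lt_trans xy rs.
Qed.

Lemma kball_sym k x y r : kball k x r y -> kball k y r x.
Proof. by case: k => /=; rewrite ?ballEmdist/= (metric_sym x). Qed.

Lemma kball_triangle k x y z r s :
  kball k x r y -> kball k y s z -> kball k x (r + s) z.
Proof.
case: k => /=; first exact: ball_triangle.
by move=> xy yz; rewrite (le_trans (metric_triangle _ y _))// lerD.
Qed.

Lemma kball_lty k x r : (mu (kball k x r) < +oo)%E.
Proof.
apply: (mms_bounded_finite Xmu); first exact: measurable_kball.
exists (r + r) => y z xy xz.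
have := kball_triangle (kball_sym xy) xz.
by case: k {xy xz} => //=; rewrite ballEmdist/= => /ltW.
Qed.

Lemma ball_lty x r : (mu (ball x r) < +oo)%E.
Proof. exact: (kball_lty OpenBall). Qed.

Lemma near_ball_nat x y : \forall n \near \oo, ball x n%:R y.
Proof.
by near=> n; rewrite ballEmdist/=; near: n; exact: nbhs_infty_gtr.
Unshelve. all: by end_near. Qed.

Lemma mms_sigma_finite : sigma_finite setT mu.
Proof.
exists (fun n => ball (point : X) n%:R).
  apply/seteqP; split => // y _.
  by have [n _ /(_ _ (leqnn n))] := near_ball_nat point y; exists n.
by move=> n; split; [exact: measurable_metric_ball|exact: ball_lty].
Qed.

(** Exhibits the complement of the support as a union of null open sets, the
    form in which tau-additivity applies to it. *)
Lemma msupport_setCE : exists F : set (set X), [/\ ~` supp = \bigcup_(U in F) U,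
  forall U, F U -> open U & forall U, F U -> mu U = 0%E].
Proof.
exists [set ball xr.1 xr.2 |
  xr in [set xr : X * R | 0 < xr.2 /\ mu (ball xr.1 xr.2) = 0%E]].
split.
- by rewrite /supp /msupport setCK bigcup_image.
- by move=> _ [xr _ <-]; exact: metric_ball_open.
- by move=> _ [xr [_ ?] <-].
Qed.

Lemma open_msupportC : open (~` supp).
Proof.
by have [F [-> oF _]] := msupport_setCE; exact: bigcup_open.
Qed.

Lemma measurable_msupport : measurable supp.
Proof.
rewrite -(setCK supp); apply: measurableC; apply: open_measurable_mms.
exact: open_msupportC.
Qed.

Lemma mu_msupportC : mu (~` supp) = 0%E.
Proof.
have [F [-> oF F0]] := msupport_setCE.
apply/eqP; rewrite eq_le measure_ge0 andbT (mms_tau_additive Xmu oF).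
apply: ge_ereal_sup => _ [G [Gfin GF] <-].
have mG U : G U -> measurable U by move=> /GF/oF/open_measurable_mms.
have /finite_seqP[s Gs] := Gfin.
have : forall U, U \in s -> G U by move=> U; rewrite Gs.
have -> : \bigcup_(U in G) U = \bigcup_(U in [set` s]) U by rewrite Gs.
rewrite bigcup_seq; elim: s {Gs} => [_|U s ih sG].
  by rewrite big_nil measure0.
rewrite big_cons (le_trans (measureU2 _ _ _))//.
- by apply: mG; apply: sG; rewrite mem_head.
- rewrite big_seq; apply: bigsetU_measurable => V Vs.
  by apply: mG; apply: sG; rewrite in_cons Vs orbT.
- have U0 : (mu U <= 0)%E by rewrite F0//; apply/GF/sG; rewrite mem_head.
  rewrite -[leRHS]adde0; apply: (leeD U0); apply: ih => V Vs.
  by apply: sG; rewrite in_cons Vs orbT.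
Qed.

Lemma msupport_ball_gt0 x r : supp x -> 0 < r -> (0 < mu (ball x r))%E.
Proof.
move=> sx r0; rewrite lt0e measure_ge0 andbT; apply/eqP => xr0.
apply: sx; exists (x, r) => //=.
by rewrite ballEmdist/= mdistxx.
Qed.

Lemma msupport_kball_gt0 k x r : supp x -> 0 < r -> (0 < mu (kball k x r))%E.
Proof.
move=> sx r0; apply: lt_le_trans (msupport_ball_gt0 sx r0) _.
rewrite le_measure ?inE//; [exact: measurable_metric_ball|exact: measurable_kball|].
exact: ball_sub_kball.
Qed.

(** Tau-additivity applied to the cover of [A] by the open sets
    [ball y e `&` A]. *)
Lemma finitely_many_balls (A : set X) e (eta : R) : open A -> (mu A < +oo)%E ->
  0 < e -> 0 < eta ->
  exists s : seq X, (mu A < mu (\bigcup_(y in [set` s]) ball y e `&` A) + eta%:E)%E.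
Proof.
move=> oA Aoo e0 eta0.
pose F := [set ball y e `&` A | y in [set: X]].
have oF U : F U -> open U.
  by move=> [y _ <-]; apply: openI => //; exact: metric_ball_open.
have FA : \bigcup_(U in F) U = A.
  apply/seteqP; split => [y [_ [z _ <-]] [_]//|y Ay].
  by exists (ball y e `&` A); [exists y|split => //; rewrite ballEmdist/= mdistxx].
have := mms_tau_additive Xmu oF; rewrite FA => muA.
have Afin : mu A \is a fin_num by rewrite ge0_fin_numE.
have := Afin; rewrite {1}muA => /(ub_ereal_sup_adherent eta0)[_ [G [Gfin GF] <-]].
rewrite -muA => lt_A.
have /choice[c hc] (U : set X) : exists y : X, F U -> U = ball y e `&` A.
  have [[y _ <-]|nF] := pselect (F U); first by exists y.
  by exists point.
have /finite_seqP[s Gs] := Gfin.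
exists (map c s).
rewrite lteBlDr// in lt_A; apply: (lt_le_trans lt_A); rewrite leeD2r//.
rewrite le_measure ?inE//.
- apply: open_measurable_mms; apply: bigcup_open => U GU; exact/oF/GF.
- apply: measurableI; last exact: open_measurable_mms.
  apply: open_measurable_mms; apply: bigcup_open => U _; exact: metric_ball_open.
- move=> y [U GU Uy]; move: (Uy); rewrite {1}(hc U (GF _ GU)) => -[cy Ay].
  by split => //; exists (c U) => //=; apply: map_f; rewrite Gs in GU.
Qed.

(** [Q] enumerates the centres of the finitely many balls of radius [1/(n+1)]
    that fill a ball of radius [N] up to measure [1/(m+1)], for all [N], [n],
    [m].  A small ball around a point [x] of the support has positive measure,
    so for large [m] it cannot avoid all of them, and [x] is close to one of the
    centres.  The points of [Q] themselves may lie outside the support. *)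
Lemma msupport_separable :
  exists Q : nat -> X, forall x e, supp x -> 0 < e -> exists n, mdist x (Q n) < e.
Proof.
pose A N : set X := ball point N%:R.
have inv0 n : 0 < n.+1%:R^-1 :> R by rewrite invr_gt0.
have /choice[s sP] (u : nat * nat * nat) : exists s : seq X,
    (mu (A u.1.1) <
     mu (\bigcup_(y in [set` s]) ball y u.1.2.+1%:R^-1 `&` A u.1.1)
       + (u.2.+1%:R^-1)%:E)%E.
  by apply: finitely_many_balls => //; [exact: metric_ball_open|exact: ball_lty].
pose Q m := if unpickle m is Some (u, i) then nth (point : X) (s u) i else point.
exists Q => x e sx e0.
have e20 : 0 < e / 2 by rewrite divr_gt0.
have [n en] := ltr_add_invr e20; rewrite add0r in en.
have [N _ /(_ N (leqnn N))] := nbhs_infty_gtr (mdist point x + e / 2).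
move=> /= hN.
have xA : ball x (e / 2) `<=` A N.
  move=> z; rewrite /A !ballEmdist/= => xz.
  by rewrite (le_lt_trans (metric_triangle _ x _))// (lt_trans _ hN)// ltrD2l.
have xfin : mu (ball x (e / 2)) \is a fin_num by rewrite ge0_fin_numE// ball_lty.
have [m em] : exists m, ((m.+1%:R^-1)%:E < mu (ball x (e / 2)))%E.
  have := msupport_ball_gt0 sx e20; rewrite -(fineK xfin) lte_fin => /ltr_add_invr[m].
  by rewrite add0r => hm; exists m; rewrite lte_fin.
pose U := \bigcup_(y in [set` s (N, n, m)]) ball y n.+1%:R^-1.
have mU : measurable U.
  apply: open_measurable_mms; apply: bigcup_open => y _; exact: metric_ball_open.
have mA : measurable (A N) by exact: measurable_metric_ball.
have mB := measurable_metric_ball x (e / 2).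
have [z [xz [q qs qz]]] : ball x (e / 2) `&` U !=set0.
  apply/set0P/eqP => BU0; have := sP (N, n, m); rewrite /= -/U.
  apply/negP; rewrite -leNgt.
  apply: (@le_trans _ _ (mu (U `&` A N) + mu (ball x (e / 2)))%E).
    by rewrite leeD2l// ltW.
  rewrite -measureU//; last 2 first.
  - exact: measurableI.
  - apply/seteqP; split => // t [[Ut _] Bt].
    by have : (ball x (e / 2) `&` U) t by []; rewrite BU0.
  rewrite le_measure ?inE//.
  - by apply: measurableU => //; exact: measurableI.
  - by move=> t [[]//|/xA].
exists (pickle ((N, n, m), index q (s (N, n, m)))).
rewrite /Q pickleK nth_index//.
move: xz qz; rewrite !ballEmdist/= => xz qz.
rewrite (le_lt_trans (metric_triangle _ z _))// [ltRHS]splitr ltrD//.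
by rewrite metric_sym (lt_trans qz).
Qed.

End metric_measure_space_theory.
(** * The averaging kernel *)

Section kernel_of_averages.
Context (d : measure_display) (R : realType) (X : measurableMetricType d R).
Variable mu : {sigma_finite_measure set X -> \bar R}.
Hypothesis Xmu : metric_measure_space mu.
Implicit Types (x y z : X) (r e : R) (k : ball_kind).

Let supp : set X := msupport mu.

Definition near_pairs k r : set (X * X) :=
  [set u | [/\ supp u.1, supp u.2 & kball k u.1 r u.2]].

(** Separability of the support is used here: for open balls the set is a
    countable union of rectangles, built on small balls around a sequence that
    approximates all points of the support. *)
Lemma measurable_near_pairs k r : measurable (near_pairs k r).
Proof.
have ms : measurable supp := measurable_msupport Xmu.
have [Q Qdense] := msupport_separable Xmu.
have open_case s : measurable (near_pairs OpenBall s).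
  have -> : near_pairs OpenBall s = \bigcup_n \bigcup_i
      ((supp `&` ball (Q i) n.+1%:R^-1) `*` (supp `&` ball (Q i) (s - n.+1%:R^-1))).
    apply/seteqP; split => [[x y] [/= sx sy]|[x y] [n _ [i _ [[/= sx xQ] [sy yQ]]]]].
      rewrite ballEmdist/= => xy.
      have gap : 0 < (s - mdist x y) / 2 by rewrite divr_gt0// subr_gt0.
      have [n] := ltr_add_invr gap; rewrite add0r => hn.
      have [i xQ] := Qdense x n.+1%:R^-1 sx ltac:(by rewrite invr_gt0).
      exists n => //; exists i => //; split; split => //=; rewrite ballEmdist/=.
        by rewrite metric_sym.
      move: (n.+1%:R^-1) hn xQ => c hc xQ; rewrite (le_lt_trans (metric_triangle _ x _))//.
      by rewrite (metric_sym (Q i)); lra.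
    split => //=; move: xQ yQ; rewrite !ballEmdist/= => xQ yQ.
    rewrite (le_lt_trans (metric_triangle _ (Q i) _))// (metric_sym x).
    by rewrite -(subrK (n.+1%:R^-1) s) addrC ltrD.
  apply: bigcupT_measurable => n; apply: bigcupT_measurable => i.
  by apply: measurableX; apply: measurableI => //; exact: (measurable_metric_ball Xmu).
case: k => //.
have -> : near_pairs ClosedBall r = \bigcap_n near_pairs OpenBall (r + n.+1%:R^-1).
  apply/seteqP; split => [[x y] [sx sy xy] n _|[x y] xy].
    by split => //; move: xy; rewrite closed_kball_ballE; exact.
  have [sx sy _] := xy 0%N I; split => //; rewrite closed_kball_ballE => n _.
  by have [] := xy n I.
exact: bigcapT_measurable.
Qed.

Lemma xsection_near_pairs k r x : supp x ->
  xsection (near_pairs k r) x = supp `&` kball k x r.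
Proof.
move=> sx; apply/seteqP; split => y; rewrite /xsection/= inE.
  by move=> [_ sy xy].
by move=> [sy xy].
Qed.

Lemma xsection_near_pairs0 k r x : ~ supp x -> xsection (near_pairs k r) x = set0.
Proof.
by move=> sx; apply/seteqP; split => // y; rewrite /xsection/= inE => -[].
Qed.

Lemma mu_setI_msupport (A : set X) : measurable A -> mu (supp `&` A) = mu A.
Proof.
move=> mA; have ms : measurable supp := measurable_msupport Xmu.
rewrite -[in RHS](setIT A) -(setUv supp) setIUr measureU.
- rewrite setIC [X in (_ + X)%E](_ : _ = 0%E) ?adde0//.
  apply: (@subset_measure0 _ _ _ mu _ (~` supp)); last first.
  + exact: (mu_msupportC Xmu).
  + exact: subIsetr.
  + exact: measurableC.
  + by apply: measurableI => //; exact: measurableC.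
- exact: measurableI.
- by apply: measurableI => //; exact: measurableC.
- by rewrite setIACA setICr setI0.
Qed.

Lemma mu_xsection_near_pairs k r x : supp x ->
  mu (xsection (near_pairs k r) x) = mu (kball k x r).
Proof.
by move=> sx; rewrite xsection_near_pairs// mu_setI_msupport//; exact: (measurable_kball Xmu).
Qed.

(** On the support this is [1 / mu (B (x, r))].  Defined through the section of
    [near_pairs], it is measurable by Tonelli and is [0] off the support. *)
Definition inv_ball_measure k r x : R := (fine (mu (xsection (near_pairs k r) x)))^-1.

Definition averaging_kernel k r (u : X * X) : R :=
  inv_ball_measure k r u.1 * \1_(near_pairs k r) u.

Lemma inv_ball_measure_ge0 k r x : 0 <= inv_ball_measure k r x.
Proof. by rewrite invr_ge0 fine_ge0. Qed.

Lemma measurable_inv_ball_measure k r : measurable_fun setT (inv_ball_measure k r).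
Proof.
have -> : inv_ball_measure k r =
    (fun x => (fine (mu (xsection (near_pairs k r) x))) `^ (-1)).
  by apply/funext => x; rewrite powR_inv1// fine_ge0.
apply: (measurableT_comp (measurable_powR (-1))).
apply: (measurableT_comp (fine_measurable measurableT)).
exact: (measurable_fun_xsection mu (measurable_near_pairs k r)).
Qed.

Lemma measurable_averaging_kernel k r : measurable_fun setT (averaging_kernel k r).
Proof.
apply: measurable_funM.
  by apply: (measurableT_comp (measurable_inv_ball_measure k r)).
exact: (measurable_indic (measurable_near_pairs k r)).
Qed.

Lemma averaging_kernel_ge0 k r u : 0 <= averaging_kernel k r u.
Proof. by rewrite mulr_ge0 ?inv_ball_measure_ge0// indicE. Qed.

(** Restricting the kernel to pairs of points of the support does not change the
    averages, since the support has full measure. *)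
Lemma integral_averaging_kernel k r x (h : X -> \bar R) : supp x ->
  measurable_fun setT h -> (forall y, 0 <= h y)%E ->
  (\int[mu]_y ((averaging_kernel k r (x, y))%:E * h y) =
   ((fine (mu (kball k x r)))^-1)%:E * \int[mu]_(y in kball k x r) h y)%E.
Proof.
move=> sx mh h0; have ms : measurable supp := measurable_msupport Xmu.
have mB := measurable_kball Xmu k x r.
have -> : (\int[mu]_(y in kball k x r) h y = \int[mu]_(y in supp `&` kball k x r) h y)%E.
  rewrite (ge0_negligible_integral (measurableC ms))//.
  - by rewrite setDE setCK setIC.
  - exact: measurable_funTS.
  - exact: mu_msupportC.
rewrite [in RHS]integral_mkcond -ge0_integralZl_EFin//; last 3 first.
- by move=> y _; rewrite erestrict_ge0.
- apply/(measurable_restrictT _ _).1 => //; first exact: measurableI.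
  exact: measurable_funTS.
- by rewrite invr_ge0 fine_ge0.
apply: eq_integral => y _; rewrite /averaging_kernel /inv_ball_measure/=.
rewrite mu_xsection_near_pairs// patchE EFinM -muleA; congr (_ * _)%E.
have -> : (\1_(near_pairs k r) (x, y) : R) = \1_(supp `&` kball k x r) y.
  rewrite !indicE; congr (_%:R); congr nat_of_bool; apply/idP/idP; rewrite !inE.
    by move=> [].
  by move=> [].
by rewrite indicE; case: ifP => _; rewrite ?mul1e ?mul0e.
Qed.

Lemma averaging_kernel0 k r u : ~ near_pairs k r u -> averaging_kernel k r u = 0.
Proof. by move=> nu; rewrite /averaging_kernel indicE memNset// mulr0. Qed.

Lemma averaging_kernelE k r x y : near_pairs k r (x, y) ->
  averaging_kernel k r (x, y) = (fine (mu (kball k x r)))^-1.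
Proof.
move=> xy; have [sx _ _] := xy.
by rewrite /averaging_kernel /inv_ball_measure mu_xsection_near_pairs// indicE mem_set// mulr1.
Qed.

Lemma fine_kballK k x r : (fine (mu (kball k x r)))%:E = mu (kball k x r).
Proof. by rewrite fineK// ge0_fin_numE// (kball_lty Xmu). Qed.

Lemma fine_kball_gt0 k x r : supp x -> 0 < r -> 0 < fine (mu (kball k x r)).
Proof.
by move=> sx r0; rewrite -lte_fin fine_kballK (msupport_kball_gt0 Xmu).
Qed.

Lemma averaging_kernel_row k r x : 0 < r ->
  (\int[mu]_y (averaging_kernel k r (x, y))%:E <= 1)%E.
Proof.
move=> r0; have [sx|sx] := pselect (supp x); last first.
  rewrite integral0_eq ?lee01// => y _.
  by rewrite averaging_kernel0//= => -[].
have -> : (\int[mu]_y (averaging_kernel k r (x, y))%:E =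
    \int[mu]_y ((averaging_kernel k r (x, y))%:E * cst 1%E y))%E.
  by apply: eq_integral => y _; rewrite mule1.
rewrite integral_averaging_kernel//.
rewrite integral_cst; last exact: (measurable_kball Xmu).
by rewrite mul1e -[X in (_ * X)%E]fine_kballK -EFinM mulVf// gt_eqF// fine_kball_gt0.
Qed.

(** Local comparability only speaks of [mdist x y < r]; for closed balls the case
    of equality follows by letting the radius decrease to [r]. *)
Lemma kball_comparable (C : R) k x y r : 0 <= C ->
  (forall x' y' r', 0 < r' -> mdist x' y' < r' ->
    (mu (kball k x' r') <= C%:E * mu (kball k y' r'))%E) ->
  0 < r -> kball k x r y -> (mu (kball k x r) <= C%:E * mu (kball k y r))%E.
Proof.
move=> C0 hC r0; case: k hC => hC xy.
  by apply: hC => //; move: xy; rewrite /= ballEmdist.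
have dec : {homo (fun n => kball ClosedBall y (r + n.+1%:R^-1)) :
    n m / (n <= m)%N >-> (m <= n)%O}.
  move=> n m nm; apply/subsetPset => z /= /le_trans; apply.
  by rewrite lerD2l lef_pV2 ?posrE// ler_nat.
have mB s := measurable_kball Xmu ClosedBall y s.
have := nonincreasing_cvg_mu (mu := mu) (kball_lty Xmu ClosedBall y _)
  (fun n => mB (r + n.+1%:R^-1)).
rewrite -closed_kballE => /(_ (mB r) dec) /(cvgeZl (y := C%:E) erefl).
apply: cvge_ge; apply: nearW => n /=.
apply: (@le_trans _ _ (mu (kball ClosedBall x (r + n.+1%:R^-1)))).
  apply: le_measure; rewrite ?inE; [exact: (measurable_kball Xmu ClosedBall)..|].
  by move=> z /= /le_trans; apply; rewrite lerDl invr_ge0.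
apply: hC; first by rewrite addr_gt0// invr_gt0.
by rewrite (le_lt_trans xy)// ltrDl invr_gt0.
Qed.

(** For [x] in the ball around [y], comparability bounds [1 / mu (B (x, r))] by
    [C / mu (B (y, r))]; the ball around [y] then has integral at most [C]. *)
Lemma averaging_kernel_col_comparable k : local_comparability mu k ->
  exists C : R, forall r, 0 < r -> forall y,
    (\int[mu]_x (averaging_kernel k r (x, y))%:E <= C%:E)%E.
Proof.
move=> [C C1 hC]; exists C => r r0 y.
have C0 : 0 <= C by rewrite (le_trans ler01).
have [sy|sy] := pselect (supp y); last first.
  rewrite integral0_eq ?lee_fin// => x _.
  by rewrite averaging_kernel0//= => -[].
pose b := fine (mu (kball k y r)).
have b0 : 0 < b by exact: fine_kball_gt0.
have mB := measurable_kball Xmu k y r.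
apply: (@le_trans _ _ (\int[mu]_x ((C / b)%:E * (\1_(kball k y r) x)%:E))%E).
  apply: ge0_le_lower_integral => x; first by rewrite lee_fin averaging_kernel_ge0.
  rewrite -EFinM lee_fin; have [xy|xy] := pselect (near_pairs k r (x, y)); last first.
    by rewrite averaging_kernel0// mulr_ge0// ?divr_ge0 ?indicE// ltW.
  have [sx _ yB] := xy.
  rewrite averaging_kernelE// indicE mem_set; last exact: kball_sym.
  have a0 : 0 < fine (mu (kball k x r)) by exact: fine_kball_gt0.
  rewrite mulr1 ler_pdivlMr// mulrC ler_pdivrMr//.
  rewrite -lee_fin EFinM !fine_kballK; apply: kball_comparable => //.
  exact: kball_sym.
rewrite ge0_integralZl_EFin//; last 2 first.
- by apply/measurable_EFinP; exact: measurable_indic.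
- by rewrite divr_ge0// ltW.
rewrite integral_indic// setIT -[X in (_ * X)%E]fine_kballK -EFinM -/b.
by rewrite divfK// gt_eqF.
Qed.

(** A ball [B'] of radius [r / 2] is contained in the ball of radius [r] around
    any of its points [x], so on [B'] the kernel is at most [1 / mu B'] and its
    integral over [B'] is at most [1].  The ball of radius [r] around [y] is
    covered by [D] such balls. *)
Lemma averaging_kernel_col_doubling k : geometrically_doubling X k ->
  exists C : R, forall r, 0 < r -> forall y,
    (\int[mu]_x (averaging_kernel k r (x, y))%:E <= C%:E)%E.
Proof.
move=> [D _ hD]; exists D%:R => r r0 y.
have [s sD cover] := hD y r r0.
have mB z := measurable_kball Xmu k z (r / 2).
have mv := measurable_inv_ball_measure k r.
have v0 := inv_ball_measure_ge0 k r.
have mf z : measurable_fun setT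
    (fun x => (\1_(kball k z (r / 2)) x * inv_ball_measure k r x : R)%:E).
  by apply/measurable_EFinP; apply: measurable_funM => //; exact: measurable_indic.
have f0 z x : (0 <= (\1_(kball k z (r / 2)) x * inv_ball_measure k r x)%:E)%E.
  by rewrite lee_fin mulr_ge0// indicE.
apply: (@le_trans _ _ (\int[mu]_x (\sum_(z <- s)
    (\1_(kball k z (r / 2)) x * inv_ball_measure k r x)%:E))%E).
  apply: ge0_le_lower_integral => x; first by rewrite lee_fin averaging_kernel_ge0.
  rewrite sumEFin lee_fin; have [xy|xy] := pselect (near_pairs k r (x, y)); last first.
    by rewrite averaging_kernel0// sumr_ge0// => z _; rewrite -lee_fin.
  have [_ _ yB] := xy.
  have [z /= zs xz] := cover x (kball_sym yB).
  rewrite (big_rem z)//= ler_wpDr//.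
    by rewrite sumr_ge0// => z' _; rewrite -lee_fin.
  by rewrite /averaging_kernel !indicE !mem_set// mulr1 mul1r.
rewrite ge0_integral_sum//.
apply: (@le_trans _ _ (\sum_(z <- s) 1%:E)%E); last first.
  by rewrite sumEFin lee_fin big_const_seq count_predT iter_addr_0 ler_nat.
apply: lee_sum => z _.
(* A closed ball may be null although it contains points of the support, on
   its boundary. *)
have [b0|b0] := eqVneq (mu (kball k z (r / 2))) 0%E.
  have -> : (\int[mu]_x (\1_(kball k z (r / 2)) x * inv_ball_measure k r x)%:E =
     \int[mu]_(x in kball k z (r / 2)) (inv_ball_measure k r x)%:E)%E.
    rewrite [RHS]integral_mkcond; apply: eq_integral => x _.
    by rewrite patchE indicE; case: ifP; rewrite ?mul1r ?mul0r.
  rewrite null_set_integral ?lee01//.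
  by apply: measurable_funTS; exact/measurable_EFinP.
have {}b0 : 0 < fine (mu (kball k z (r / 2))).
  by rewrite -lte_fin fine_kballK lt0e b0 measure_ge0.
pose b := fine (mu (kball k z (r / 2))).
apply: (@le_trans _ _ (\int[mu]_x ((b^-1)%:E * (\1_(kball k z (r / 2)) x)%:E))%E).
  apply: ge0_le_lower_integral => // x.
  rewrite -EFinM lee_fin indicE.
  have [/set_mem xz|_] := boolP (x \in _); last by rewrite mul0r mulr0.
  rewrite mul1r mulr1; have [sx|sx] := pselect (supp x); last first.
    by rewrite /inv_ball_measure xsection_near_pairs0// measure0 invr0 invr_ge0 ltW.
  have a0 : 0 < fine (mu (kball k x r)) by exact: fine_kball_gt0.
  rewrite /inv_ball_measure mu_xsection_near_pairs// lef_pV2 ?posrE//.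
  rewrite -lee_fin !fine_kballK le_measure ?inE//; first exact: (measurable_kball Xmu).
  by move=> t zt; rewrite (splitr r); exact: kball_triangle (kball_sym xz) zt.
rewrite ge0_integralZl_EFin//; last 2 first.
- by apply/measurable_EFinP; exact: measurable_indic.
- by rewrite invr_ge0 ltW.
by rewrite integral_indic// setIT -[X in (_ * X)%E]fine_kballK -EFinM mulVf// gt_eqF.
Qed.

Lemma averaging_kernel_schur k :
  geometrically_doubling X k \/ local_comparability mu k ->
  exists C : R, forall r, 0 < r -> schur_kernel mu C (averaging_kernel k r).
Proof.
move=> hyp; have [C hC] : exists C : R, forall r, 0 < r -> forall y,
    (\int[mu]_x (averaging_kernel k r (x, y))%:E <= C%:E)%E.
  by case: hyp; [exact: averaging_kernel_col_doubling|exact: averaging_kernel_col_comparable].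
exists C => r r0; split => [|u|x|y].
- exact: measurable_averaging_kernel.
- exact: averaging_kernel_ge0.
- exact: averaging_kernel_row.
- exact: hC.
Qed.

(** Written with a union of balls, so that it is visibly open for [U] open. *)
Definition inner_edge (U : set X) r : set X := U `&` \bigcup_(y in ~` U) ball y r.

Lemma measurable_inner_edge (U : set X) r : open U -> measurable (inner_edge U r).
Proof.
move=> oU; apply: (open_measurable_mms Xmu); apply: openI => //.
by apply: bigcup_open => y _; exact: metric_ball_open.
Qed.

Lemma inner_edgeS (U : set X) r s : r <= s -> inner_edge U r `<=` inner_edge U s.
Proof.
move=> rs x [Ux [y Uy yx]]; split => //; exists y => //.
by move: yx; rewrite !ballEmdist/= => /lt_le_trans; exact.
Qed.

Lemma mu_inner_edge_small (U : set X) (e : R) :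
  open U -> (mu U < +oo)%E -> 0 < e ->
  exists2 r : R, 0 < r & (mu (inner_edge U r) <= e%:E)%E.
Proof.
move=> oU Uoo e0.
pose F n := inner_edge U n.+1%:R^-1.
have mF n : measurable (F n) by exact: measurable_inner_edge.
have F0 : \bigcap_n F n = set0.
  apply/seteqP; split => // x Fx; have [Ux _] := Fx 0%N I.
  move: oU; rewrite openE => /(_ _ Ux)/nbhs_ballP[s /= s0 xsU].
  have [n] := ltr_add_invr s0; rewrite add0r => ns.
  have [_ [y Uy]] := Fx n I; rewrite ballEmdist/= => yx.
  by apply: Uy; apply: xsU; rewrite ballEmdist/= metric_sym (lt_trans yx).
have Fdec : {homo F : n m / (n <= m)%N >-> (m <= n)%O}.
  move=> n m nm; apply/subsetPset; apply: inner_edgeS.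
  by rewrite lef_pV2 ?posrE// ler_nat.
have FU : (mu (F 0%N) < +oo)%E.
  apply: le_lt_trans Uoo; apply: le_measure; rewrite ?inE//.
    exact: (open_measurable_mms Xmu oU).
  exact: subIsetl.
have mcap : measurable (\bigcap_n F n) by rewrite F0.
have := nonincreasing_cvg_mu (mu := mu) FU mF mcap Fdec.
rewrite F0 measure0 => /(ge0_cvge0P _ (fun n => measure_ge0 mu (F n))).1 /(_ _ e0)[n _ hn].
by exists n.+1%:R^-1; rewrite ?invr_gt0//; exact: hn (leqnn n).
Qed.

(** If [x] and [y] are within [r] and exactly one of them is in [U], that one
    lies in [inner_edge U s] for every [s > r].  So the integrand is at most
    [K (x, y)] times the sum of the indicators of the edge at [x] and at [y], and
    Schur's test applies.  The points [x] outside [U] are thus handled by the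
    column bound, although the averages there need not be small pointwise. *)
Lemma osc_vanishes_open k C p (U : set X) : 0 < p ->
  (forall r, 0 < r -> schur_kernel mu C (averaging_kernel k r)) ->
  open U -> (mu U < +oo)%E ->
  osc_vanishes mu p (averaging_kernel k) (\1_U : X -> R).
Proof.
move=> p0 kK oU Uoo e e0.
have C1 : 0 < 1 + `|C| by rewrite ltr_pwDl.
have [s s0 hs] := mu_inner_edge_small oU Uoo (divr_gt0 e0 C1).
pose E := inner_edge U s; have mE : measurable E by exact: measurable_inner_edge.
near=> r; have r0 : 0 < r by near: r; exact: nbhs_right_gt.
have rs : r < s by near: r; exact: nbhs_right_lt.
have ind01 (A : set X) x : 0 <= (\1_A : X -> R) x by rewrite indicE.
have mi := @measurable_indic _ X R setT E mE.
have := schur_test (kK r r0) mi mi (ind01 E) (ind01 E).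
rewrite integral_indic// setIT => schur.
apply: (@le_trans _ _ (mu E + `|C|%:E * mu E)%E); last first.
  rewrite (_ : e%:E = ((e / (1 + `|C|))%:E + `|C|%:E * (e / (1 + `|C|))%:E)%E); last first.
    by rewrite -EFinM -EFinD; congr EFin; field; rewrite gt_eqF.
  by apply: (leeD hs); apply: lee_wpmul2l => //; rewrite lee_fin.
apply: (@le_trans _ _ (mu E + C%:E * mu E)%E); last first.
  by apply: leeD2l; apply: lee_wpmul2r => //; rewrite lee_fin ler_norm.
apply: le_trans schur; apply: ge0_le_lower_integral => x.
  by apply: integral_ge0 => y _; rewrite lee_fin mulr_ge0 ?powR_ge0// averaging_kernel_ge0.
apply: ge0_le_lower_integral => y.
  by rewrite lee_fin mulr_ge0 ?powR_ge0// averaging_kernel_ge0.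
rewrite lee_fin; have [xy|xy] := pselect (near_pairs k r (x, y)); last first.
  by rewrite averaging_kernel0// !mul0r.
rewrite ler_wpM2l ?averaging_kernel_ge0//.
have [_ _ yB] := xy; have yb := kball_sub_ball rs yB.
have xb : ball y s x by exact: (kball_sub_ball rs (kball_sym yB)).
rewrite !indicE; have [/set_mem Ux|/negP Ux] := boolP (x \in U);
  have [/set_mem Uy|/negP Uy] := boolP (y \in U);
  rewrite /= ?subrr ?normr0 ?powR0 ?gt_eqF ?addr_ge0//.
- rewrite sub0r normrN normr1 powR1 mem_set ?lerDl//; split => //.
  by exists y => //; apply: contra_not Uy => /mem_set.
- rewrite subr0 normr1 powR1 (@mem_set _ E y) ?lerDr//; split => //.
  by exists x => //; apply: contra_not Ux => /mem_set.
Unshelve. all: by end_near. Qed.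

Lemma osc_vanishes_averaging k C p (f : X -> R) : 0 < p ->
  (forall r, 0 < r -> schur_kernel mu C (averaging_kernel k r)) ->
  measurable_fun setT f -> (\int[mu]_x (`|f x| `^ p)%:E < +oo)%E ->
  osc_vanishes mu p (averaging_kernel k) f.
Proof.
move=> p0 kK; apply: (osc_vanishes_Lp p0 kK (mms_borel Xmu) (@openI X)
  (fun U oU => osc_vanishes_open p0 kK oU)).
- by move=> n; exact: (metric_ball_open (point : X) n%:R).
- by move=> n; exact: (ball_lty Xmu).
- exact: near_ball_nat.
Qed.

End kernel_of_averages.
(** * Convexity: the power of a mean is at most the mean of the powers *)

(** The graph of the [p]-th power lies above its tangent at [a]; this is Young's
    inequality for the conjugate exponents [p] and [p / (p - 1)]. *)
Lemma powR_tangent (R : realType) (p a t : R) : 1 <= p -> 0 <= a -> 0 <= t ->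
  p * a `^ (p - 1) * t <= t `^ p + (p - 1) * a `^ p.
Proof.
move=> p1 a0 t0; have [->|pn1] := eqVneq p 1.
  by rewrite subrr powRr0 powRr1// mul0r addr0 !mul1r.
have p_gt1 : 1 < p by rewrite lt_neqAle eq_sym pn1.
have p0 : 0 < p by rewrite (lt_trans ltr01).
have p10 : 0 < p - 1 by rewrite subr_gt0.
have q0 : 0 < p / (p - 1) by rewrite divr_gt0.
have conj : p^-1 + (p / (p - 1))^-1 = 1.
  by field; rewrite !gt_eqF.
have := conjugate_powR t0 (powR_ge0 a (p - 1)) p0 q0 conj.
rewrite -powRrM (_ : (p - 1) * (p / (p - 1)) = p); last by field; rewrite gt_eqF.
rewrite -(ler_pM2l p0) => /le_trans h.
rewrite -mulrA [X in _ * X]mulrC; apply: h.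
by rewrite le_eqVlt; apply/orP; left; apply/eqP; field; rewrite !gt_eqF.
Qed.

Section power_mean.
Context (d : measure_display) (T : measurableType d) (R : realType).
Variables (mu : {measure set T -> \bar R}) (B : set T) (p : R) (h : T -> R).
Hypotheses (mB : measurable B) (muB_lty : (mu B < +oo)%E) (p1 : 1 <= p)
  (mh : measurable_fun setT h)
  (hp : (\int[mu]_(y in B) (`|h y| `^ p)%:E < +oo)%E).

Let mhp : measurable_fun B (fun y => (`|h y| `^ p)%:E).
Proof.
apply/measurable_EFinP; apply: measurable_funTS; exact: measurable_powR_norm.
Qed.

Let mnh : measurable_fun B (fun y => (`|h y|)%:E).
Proof.
by apply/measurable_EFinP; apply: measurable_funTS; exact: measurableT_comp.
Qed.

Let p_gt0 : 0 < p. Proof. exact: lt_le_trans p1. Qed.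

Let muBE : (fine (mu B))%:E = mu B. Proof. by rewrite fineK// ge0_fin_numE. Qed.

Let integral_tangent a : 0 <= a ->
  ((p * a `^ (p - 1))%:E * \int[mu]_(y in B) (`|h y|)%:E <=
   \int[mu]_(y in B) (`|h y| `^ p)%:E + ((p - 1) * a `^ p)%:E * mu B)%E.
Proof.
move=> a0; have c0 : 0 <= (p - 1) * a `^ p by rewrite mulr_ge0 ?powR_ge0 ?subr_ge0.
rewrite -ge0_integralZl_EFin//; last by rewrite mulr_ge0 ?powR_ge0 ?ltW.
rewrite -(integral_cst mu mB) -ge0_integralD//.
apply: ge0_le_integral => //.
- by move=> y _; rewrite -EFinM lee_fin !mulr_ge0 ?powR_ge0 ?normr_ge0// ltW.
- by apply: emeasurable_funM => //; exact: measurable_cst.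
- by apply: emeasurable_funD => //; exact: measurable_cst.
- by move=> y _; rewrite -EFinM -EFinD lee_fin powR_tangent.
Qed.

(** The tangent at [1] bounds [|h|] by [|h|^p] plus a constant. *)
Lemma integrable_of_powR : mu.-integrable B (EFin \o h).
Proof.
apply/integrableP; split.
  by apply/measurable_EFinP; exact: measurable_funTS.
have := integral_tangent ler01; rewrite !powR1 !mulr1 => hle.
have : (p%:E * \int[mu]_(y in B) `|h y|%:E < +oo)%E.
  apply: le_lt_trans hle _; rewrite lte_add_pinfty//.
  by rewrite -muBE -EFinM ltry.
have : (0 <= \int[mu]_(y in B) `|h y|%:E)%E.
  by apply: integral_ge0 => y _; rewrite lee_fin.
rewrite /=; case: (\int[mu]_(y in B) `|h y|%:E)%E => [s| |] _ //.
  by move=> _; exact: ltry.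
by rewrite gt0_muley// lte_fin.
Qed.

(** Jensen's inequality: integrate the tangent inequality at the mean of [|h|]. *)
Lemma powR_average_le : (0 < mu B)%E ->
  ((`|(fine (mu B))^-1 * (\int[mu]_(y in B) h y)| `^ p)%:E <=
   ((fine (mu B))^-1)%:E * \int[mu]_(y in B) (`|h y| `^ p)%:E)%E.
Proof.
move=> muB0; pose b := fine (mu B).
have b0 : 0 < b by rewrite -lte_fin muBE.
have ih := integrable_of_powR.
pose I1 := \int[mu]_(y in B) `|h y|.
have I10 : 0 <= I1 by apply: Rintegral_ge0.
have I1E : (\int[mu]_(y in B) `|h y|%:E)%E = I1%:E.
  by rewrite /I1 /Rintegral fineK//; exact: (integrable_fin_num mB (integrable_norm ih)).
pose a := b^-1 * I1; have a0 : 0 <= a by rewrite mulr_ge0// invr_ge0 ltW.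
have le_a : `|b^-1 * (\int[mu]_(y in B) h y)| <= a.
  rewrite normrM gtr0_norm ?invr_gt0//; apply: ler_wpM2l.
    by rewrite invr_ge0 ltW.
  exact: (le_normr_Rintegral mB ih).
apply: (@le_trans _ _ (a `^ p)%:E).
  by rewrite lee_fin ge0_ler_powR ?nnegrE// ltW.
have Ipfin : (\int[mu]_(y in B) (`|h y| `^ p)%:E)%E \is a fin_num.
  by rewrite ge0_fin_numE// integral_ge0// => y _; rewrite lee_fin powR_ge0.
have := integral_tangent a0; rewrite I1E -muBE -/b -(fineK Ipfin) -!EFinM -EFinD !lee_fin.
rewrite (_ : p * a `^ (p - 1) * I1 = p * b * a `^ p); last first.
  rewrite -(mulr_powRB1 a0 p_gt0) /a; field; rewrite gt_eqF//.
move=> hle; rewrite mulrC ler_pdivlMr//.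
rewrite (_ : a `^ p * b = p * b * a `^ p - (p - 1) * a `^ p * b); last by ring.
by rewrite lerBlDr.
Qed.

End power_mean.
(** * Convergence of the averages in L^p *)

Section averaging_error.
Context (d : measure_display) (R : realType) (X : measurableMetricType d R).
Variable mu : {sigma_finite_measure set X -> \bar R}.
Hypothesis Xmu : metric_measure_space mu.
Variables (p : R) (f : X -> R).
Hypotheses (p1 : 1 <= p) (mf : measurable_fun setT f)
  (fp : (\int[mu]_x (`|f x| `^ p)%:E < +oo)%E).

Let p0 : 0 < p. Proof. exact: lt_le_trans p1. Qed.

Let shifted_powR_lty (B : set X) c : measurable B -> (mu B < +oo)%E ->
  (\int[mu]_(y in B) (`|f y - c| `^ p)%:E < +oo)%E.
Proof.
move=> mB Boo.
have mfp : measurable_fun setT (fun x => (`|f x| `^ p)%:E).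
  by apply/measurable_EFinP; exact: measurable_powR_norm.
have mfB : measurable_fun B (fun x => (`|f x| `^ p)%:E) by exact: measurable_funTS.
have fB : (\int[mu]_(y in B) (`|f y| `^ p)%:E < +oo)%E.
  apply: le_lt_trans fp; apply: ge0_subset_integral => //.
apply: (@le_lt_trans _ _ (\int[mu]_(y in B)
    ((2 `^ p)%:E * ((`|f y| `^ p)%:E + (`|c| `^ p)%:E)))%E).
  apply: ge0_le_integral => //.
  - apply/measurable_EFinP; apply: measurable_funTS.
    by apply: measurable_powR_norm; exact: measurable_funB.
  - apply: emeasurable_funM; first exact: measurable_cst.
    by apply: emeasurable_funD => //; exact: measurable_cst.
  - by move=> y _; rewrite -EFinD -EFinM lee_fin -(normrN c) powR_normD// ltW.
have mD : measurable_fun B (fun y => (`|f y| `^ p)%:E + (`|c| `^ p)%:E)%E.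
  by apply: emeasurable_funD => //; exact: measurable_cst.
have s0 y : B y -> (0 <= (`|f y| `^ p)%:E + (`|c| `^ p)%:E)%E.
  by move=> _; rewrite -EFinD lee_fin addr_ge0 ?powR_ge0.
rewrite (ge0_integralZl_EFin _ mB s0 mD) ?powR_ge0//.
rewrite (ge0_integralD _ mB (fun y _ => powR_ge0 `|f y| p : (0 <= _%:E)%E) mfB
  (fun _ _ => powR_ge0 `|c| p : (0 <= _%:E)%E))//.
rewrite lte_mul_pinfty ?lee_fin ?powR_ge0// lte_add_pinfty//.
rewrite (integral_cst mu mB) -ge0_fin_numE ?mule_ge0//.
by rewrite fin_numM// ge0_fin_numE.
Qed.

Lemma powR_averaging_error_le k r x : msupport mu x -> 0 < r ->
  ((`|averaging mu k r f x - f x| `^ p)%:E <=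
   \int[mu]_y (averaging_kernel mu k r (x, y) * `|f y - f x| `^ p)%:E)%E.
Proof.
move=> sx r0; have mB := measurable_kball Xmu k x r.
have Boo := kball_lty Xmu k x r.
have B0 := msupport_kball_gt0 Xmu k sx r0.
have b0 : fine (mu (kball k x r)) != 0 by rewrite gt_eqF// fine_kball_gt0.
have -> : averaging mu k r f x - f x =
    (fine (mu (kball k x r)))^-1 * \int[mu]_(y in kball k x r) (f y - f x).
  have If : mu.-integrable (kball k x r) (EFin \o f).
    apply: (integrable_of_powR mB Boo p1 mf).
    by under eq_integral do rewrite -(subr0 (f _)); exact: shifted_powR_lty.
  have Ic : mu.-integrable (kball k x r) (EFin \o cst (f x)).
    apply/integrableP; split; first by apply/measurable_EFinP; exact: measurable_cst.
    rewrite (eq_integral (cst `|f x|%:E))// (integral_cst mu mB) -ge0_fin_numE ?mule_ge0//.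
    by rewrite fin_numM// ge0_fin_numE.
  rewrite (RintegralB mB If Ic) Rintegral_cst//.
  by rewrite /averaging patchE mem_set// mulrBr mulrCA mulVf// mulr1.
have mfx : measurable_fun setT (fun y => f y - f x) by exact: measurable_funB.
have := powR_average_le mB Boo p1 mfx (shifted_powR_lty _ mB Boo) B0.
move=> /le_trans; apply.
rewrite -(integral_averaging_kernel Xmu k r sx); last 2 first.
- by apply/measurable_EFinP; exact: measurable_powR_norm.
- by move=> y; rewrite lee_fin powR_ge0.
by under eq_integral do rewrite -EFinM.
Qed.

Lemma integral_averaging_error_le k r C :
  schur_kernel mu C (averaging_kernel mu k r) -> 0 < r ->
  (\int[mu]_x (`|averaging mu k r f x - f x| `^ p)%:E <=
   oscillation mu p (averaging_kernel mu k r) f)%E.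
Proof.
move=> kK r0; have ms := measurable_msupport Xmu.
pose F x := (\int[mu]_y (averaging_kernel mu k r (x, y) * `|f y - f x| `^ p)%:E)%E.
have pz (u : X * X) :
    (0 <= (averaging_kernel mu k r u * `|f u.2 - f u.1| `^ p : R)%:E)%E.
  by rewrite lee_fin mulr_ge0 ?powR_ge0// averaging_kernel_ge0.
have mF : measurable_fun setT F.
  exact: (measurable_fun_fubini_tonelli_F _ (measurable_osc_integrand p kK mf) pz).
have F0 x : (0 <= F x)%E by apply: integral_ge0 => y _; exact: (pz (x, y)).
(* [N] has integral [0] and dominates the error off the support, where the
   kernel vanishes while [f] need not. *)
pose N := ((cst +oo%E : X -> \bar R) \_ (~` msupport mu)).
have mN : measurable_fun setT N.
  by apply/(measurable_restrictT _ (measurableC ms)).1; exact: measurable_cst.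
have N0 x : (0 <= N x)%E by rewrite /N patchE; case: ifP => //= _; rewrite leey.
have -> : oscillation mu p (averaging_kernel mu k r) f = (\int[mu]_x (F x + N x))%E.
  rewrite ge0_integralD// -(integral_mkcond (~` msupport mu)).
  rewrite integral_cst; last exact: measurableC.
  by rewrite [X in (+oo * X)%E](mu_msupportC Xmu) mule0 adde0.
apply: ge0_le_lower_integral => x; first by rewrite lee_fin powR_ge0.
have [sx|sx] := pselect (msupport mu x).
  by rewrite (le_trans (powR_averaging_error_le _ sx r0))// leeDl.
by rewrite /N patchE mem_set// addey ?leey// gt_eqF// (lt_le_trans _ (F0 x)).
Qed.

Lemma averaging_cvg k :
  geometrically_doubling X k \/ local_comparability mu k ->
  ('N[mu]_(p%:E)[(fun x => (averaging mu k r f x - f x)%:E)])%E @[r --> 0^'+]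
    --> 0%E.
Proof.
move=> /(averaging_kernel_schur Xmu)[C kK].
apply/ge0_cvge0P => [r|e e0]; first exact: Lnorm_ge0.
have ep : 0 < e `^ p by rewrite powR_gt0.
have := osc_vanishes_averaging Xmu p0 kK mf fp ep.
apply: filterS2; last exact: nbhs_right_gt.
move=> r r0 osc_e; rewrite unlock.
under eq_integral do rewrite abse_EFin poweR_EFin.
have -> : e%:E = (((e `^ p)%:E) `^ p^-1)%E.
  by rewrite poweR_EFin -powRrM mulfV ?gt_eqF// powRr1// ltW.
apply: gt0_ler_poweR.
- by rewrite invr_ge0 ltW.
- by rewrite in_itv/= leey andbT integral_ge0// => x _; rewrite lee_fin powR_ge0.
- by rewrite in_itv/= leey andbT lee_fin powR_ge0.
- exact: le_trans (integral_averaging_error_le (kK _ r0) r0) osc_e.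
Qed.

End averaging_error.

Unset Implicit Arguments.
Set Strict Implicit.

Theorem corollary3p7 (d : measure_display) (R : realType)
    (X : measurableMetricType d R) (mu : {measure set X -> \bar R})
    (k : ball_kind)
    (Xmu : metric_measure_space mu)
    (doubling_or_comparable :
      geometrically_doubling X k \/ local_comparability mu k)
    (p : R) (p1 : 1 <= p) (f : X -> R) (fLp : f \in Lfun mu p%:E) :
  ('N[mu]_(p%:E)[(fun x => (averaging mu k r f x - f x)%:E)])%E @[r --> 0^'+]
    --> 0%E.
Proof.
have [m mE] := sigma_finite_measure_of (mms_sigma_finite Xmu).
rewrite -{}mE in Xmu doubling_or_comparable fLp *.
apply: averaging_cvg => //.
  by move: fLp; rewrite inE => /andP[/[!inE]].
have /integrableP[_] := Lfun_integrable p1 fLp.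
apply: le_lt_trans; apply: ge0_le_lower_integral => x; first by rewrite lee_fin powR_ge0.
by rewrite gee0_abs ?lee_fin ?powR_ge0.
Qed.
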